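(* Let $(X,\leq)$ be a partially ordered set and let $d$ be a metric on $X$ such that $(X,d)$ is a complete metric space. Assume that $X$ has the following property: (i) if a nondecreasing sequence $\{x_n\}$ in $X$ converges to $x\in X$, then $x_n\leq x$ for all $n$; (ii) if a nonincreasing sequence $\{y_n\}$ in $X$ converges to $y\in X$, then $y_n\geq y$ for all $n$. Let $F: X\times X\to X$ be a mapping having the mixed monotone property on $X$. Assume that there exist $\alpha,\beta>0$ with $\alpha+\beta<1$ such that $$d(F(x,y),F(u,v))\leq \alpha\, M((x,y),(u,v))+\frac{\beta}{2}\,[d(x,u)+d(y,v)]$$ for all $(x,y),(u,v)\in X\times X$ with $x\geq u$ and $y\leq v$. Assume also that there exist $x_0,y_0\in X$ such that $$x_0\leq F(x_0,y_0)\quad\text{and}\quad y_0\geq F(y_0,x_0).$$ Then $F$ has a coupled fixed point $(x,y)\in X\times X$.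
   Context: Let $(X,\leq)$ be a partially ordered set with a metric $d$, and let $F:X\times X\to X$. Mixed monotone property: $F$ has the mixed monotone property on $X$ if for any $x,y\in X$: for all $x_1,x_2\in X$, $x_1\leq x_2$ implies $F(x_1,y)\leq F(x_2,y)$; and for all $y_1,y_2\in X$, $y_1\leq y_2$ implies $F(x,y_1)\geq F(x,y_2)$. Coupled fixed point: $(x,y)\in X\times X$ is a coupled fixed point of $F$ if $F(x,y)=x$ and $F(y,x)=y$. The quantity $M$: for $(x,y),(u,v)\in X\times X$, $M((x,y),(u,v))$ denotes $$\min\left\{d(x,F(x,y))\,\frac{2+d(u,F(u,v))+d(v,F(v,u))}{2+d(x,u)+d(y,v)},\ d(u,F(u,v))\,\frac{2+d(x,F(x,y))+d(y,F(y,x))}{2+d(x,u)+d(y,v)}\right\}.$$ *)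

(* Defs.v *)
From HB Require Import structures.
From mathcomp Require Import all_boot all_order all_algebra.
From mathcomp Require Import all_classical all_reals all_analysis.

Set Implicit Arguments.
Unset Strict Implicit.
Unset Printing Implicit Defensive.

Import Order.TTheory GRing.Theory Num.Theory.

Local Open Scope classical_set_scope.
Local Open Scope ring_scope.

#[short(type="pOrderMetricType")]
HB.structure Definition POrderedMetric (d : Order.disp_t) (R : numDomainType) :=
  { T of Metric R T & Order.isPOrder d T }.

(* No compatibility between the order and the metric is built in. Complete
   types are pointed in the library, so a carrier is in particular nonempty. *)
#[short(type="completePOrderMetricType")]
HB.structure Definition CompletePOrderedMetric
    (d : Order.disp_t) (R : numDomainType) :=
  { T of POrderedMetric d R T & Complete T }.

Definition mixed_monotone (d : Order.disp_t) (X : porderType d)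
    (F : X * X -> X) : Prop :=
  forall x y : X,
    (forall x1 x2 : X, (x1 <= x2)%O -> (F (x1, y) <= F (x2, y))%O) /\
    (forall y1 y2 : X, (y1 <= y2)%O -> (F (x, y1) >= F (x, y2))%O).

Definition coupled_fixed_point (X : Type) (F : X * X -> X) (x y : X) : Prop :=
  F (x, y) = x /\ F (y, x) = y.

Definition M_term (R : realType) (X : metricType R) (F : X * X -> X)
    (p q : X * X) : R :=
  let: (x, y) := p in let: (u, v) := q in
  Num.min
    (mdist x (F (x, y)) *
      ((2 + mdist u (F (u, v)) + mdist v (F (v, u))) /
       (2 + mdist x u + mdist y v)))
    (mdist u (F (u, v)) *
      ((2 + mdist x (F (x, y)) + mdist y (F (y, x))) /
       (2 + mdist x u + mdist y v))).

(* Main.v *)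
Require Import Defs.
From mathcomp Require Import all_boot all_order all_algebra.
From mathcomp Require Import all_classical all_reals all_analysis.
From mathcomp Require Import lra.

Set Implicit Arguments.
Unset Strict Implicit.
Unset Printing Implicit Defensive.

Import Order.TTheory GRing.Theory Num.Theory.
Import numFieldNormedType.Exports.

Local Open Scope classical_set_scope.
Local Open Scope ring_scope.

(** The coupled fixed point is the limit of the iterates
    [x_(n+1) = F (x_n, y_n)], [y_(n+1) = F (y_n, x_n)] of the given starting
    pair. By mixed monotonicity [x_n] increases and [y_n] decreases, so any two
    consecutive pairs of iterates are comparable and the contraction hypothesis
    applies to them.

    Two properties of [M] make it harmless. It is symmetric ([M_termC]), so the
    contraction inequality holds whichever of the two pairs is the larger one,
    and the two coordinates play the same role. Between a pair and its image
    under [(x, y) |-> (F (x, y), F (y, x))], one of the two fractions in the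
    minimum equals 1, so [M] is at most the distance moved by the image
    ([M_term_orbit_le]). That distance is also the left-hand side of the
    contraction inequality, and [alpha < 1] lets it be absorbed
    ([contractive_step]). Summing over both coordinates, the total displacement
    shrinks at each step by the factor [beta / (1 - alpha) < 1], whence both
    sequences are Cauchy ([cauchy_geometric_steps]).

    By the order hypotheses the limit pair [(x, y)] is comparable to every
    iterate. The other term of the minimum bounds [M] between [(x_n, y_n)] and
    [(x, y)] by a fixed multiple of [d (x_n, x_(n+1))], which tends to 0;
    therefore [x_(n+1) = F (x_n, y_n)] tends to [F (x, y)], and [F (x, y) = x]
    by uniqueness of the limit ([contractive_limit_fixed]). Exchanging the
    coordinates gives [F (y, x) = y]. *)

Lemma cvg_mdist0 (R : realType) (T : metricType R) (u : nat -> T) (l : T) :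
  u n @[n --> \oo] --> l -> mdist l (u n) @[n --> \oo] --> (0 : R).
Proof.
move=> ul; apply/cvgrPdist_lt => e e0.
near=> n; rewrite sub0r normrN ger0_norm ?mdist_ge0//.
by near: n; exact: metricType_numDomainType.cvgr_dist_lt.
Unshelve. all: by end_near. Qed.

(** The tail starting at [u N] has length at most [c * q ^+ N / (1 - q)]; the
    induction keeps track of the partial geometric sum exactly. *)
Lemma cauchy_geometric_steps (R : realType) (T : metricType R) (u : nat -> T)
    (c q : R) : 0 <= c -> 0 <= q < 1 ->
  (forall n, mdist (u n) (u n.+1) <= c * q ^+ n) -> cauchy (u n @[n --> \oo]).
Proof.
move=> c0 /andP[q0 q1] uq; have q1' : 0 < 1 - q by rewrite subr_gt0.
have tail N k :
    mdist (u N) (u (N + k)%N) * (1 - q) <= c * q ^+ N - c * q ^+ (N + k).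
  elim: k => [|k IH]; first by rewrite addn0 mdistxx mul0r subrr.
  have tri := metric_triangle (u N) (u (N + k)%N) (u (N + k).+1).
  have := ler_wpM2r (ltW q1') (le_trans tri (lerD (lexx _) (uq (N + k)%N))).
  by rewrite addnS exprS; move: IH; lra.
apply: cauchy_exP => e e0.
have : geometric c q n @[n --> \oo] --> 0.
  by apply: cvg_geometric; rewrite ger0_norm.
move=> /cvgrPdist_lt /(_ (e * (1 - q)) (mulr_gt0 e0 q1')) [N _ /(_ N (leqnn N))].
rewrite /= sub0r normrN ger0_norm ?mulr_ge0 ?exprn_ge0// => cN.
exists (u N); exists N => // n /= Nn; rewrite -(subnKC Nn) ballEmdist/=.
rewrite -(ltr_pM2r q1') (le_lt_trans (tail _ _))// (le_lt_trans _ cN)//.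
by rewrite gerBl mulr_ge0// exprn_ge0.
Qed.

Lemma M_termC (R : realType) (X : metricType R) (F : X * X -> X) (p q : X * X) :
  M_term F p q = M_term F q p.
Proof.
by case: p q => x y [u v]; rewrite /M_term minC (metric_sym x u) (metric_sym y v).
Qed.

(** In the second fraction the numerator and the denominator coincide. *)
Lemma M_term_orbit_le (R : realType) (X : metricType R) (F : X * X -> X)
    (x y : X) :
  M_term F (x, y) (F (x, y), F (y, x)) <=
  mdist (F (x, y)) (F (F (x, y), F (y, x))).
Proof.
rewrite /M_term ge_min; apply/orP; right; rewrite divff ?mulr1//.
have := mdist_ge0 x (F (x, y)); have := mdist_ge0 y (F (y, x)).
by move=> *; apply: lt0r_neq0; lra.
Qed.

(** This bounds the first term of the minimum. Its distance factor vanishes in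
    the limit when [(x, y)] runs through the iterates, while the other factor
    depends only on [(u, v)]; the denominator is merely used to be at least 1. *)
Lemma M_term_le (R : realType) (X : metricType R) (F : X * X -> X)
    (x y u v : X) :
  M_term F (x, y) (u, v) <=
  mdist x (F (x, y)) * (2 + mdist u (F (u, v)) + mdist v (F (v, u))).
Proof.
rewrite /M_term ge_min; apply/orP; left; rewrite ler_wpM2l ?mdist_ge0//.
have := mdist_ge0 u (F (u, v)); have := mdist_ge0 v (F (v, u)).
have := mdist_ge0 x u; have := mdist_ge0 y v => *.
by rewrite ler_pdivrMr; nra.
Qed.

Definition mixed_comparable (d : Order.disp_t) (X : porderType d)
    (p q : X * X) : Prop :=
  ((p.1 <= q.1)%O /\ (q.2 <= p.2)%O) \/ ((q.1 <= p.1)%O /\ (p.2 <= q.2)%O).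

Lemma mixed_comparable_swap (d : Order.disp_t) (X : porderType d)
    (x y u v : X) :
  mixed_comparable (x, y) (u, v) -> mixed_comparable (y, x) (v, u).
Proof. by case=> -[]; [right | left]. Qed.

(** Unlike the hypothesis of the theorem, this form is symmetric in the two
    pairs, and hence invariant under exchanging the coordinates. *)
Definition contractive (d : Order.disp_t) (R : realType)
    (X : pOrderMetricType d R) (alpha beta : R) (F : X * X -> X) : Prop :=
  forall x y u v : X, mixed_comparable (x, y) (u, v) ->
    mdist (F (x, y)) (F (u, v)) <=
      alpha * M_term F (x, y) (u, v) + beta / 2 * (mdist x u + mdist y v).

Lemma contractive_of_ge (d : Order.disp_t) (R : realType)
    (X : pOrderMetricType d R) (alpha beta : R) (F : X * X -> X) :
  (forall x y u v : X, (x >= u)%O -> (y <= v)%O ->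
    mdist (F (x, y)) (F (u, v)) <=
      alpha * M_term F (x, y) (u, v) + beta / 2 * (mdist x u + mdist y v)) ->
  contractive alpha beta F.
Proof.
move=> ctr x y u v [[xu vy]|[ux yv]]; last exact: ctr.
by rewrite M_termC metric_sym (metric_sym x) (metric_sym y); exact: ctr.
Qed.

Section contractive_maps.
Context (d : Order.disp_t) (R : realType) (X : pOrderMetricType d R).
Context (alpha beta : R) (F : X * X -> X).
Hypotheses (alpha0 : 0 <= alpha) (ctrF : contractive alpha beta F).

(** The bound on [M] is the very distance being estimated; moving it to the
    left produces the factor [1 - alpha]. *)
Lemma contractive_step (x y : X) :
  mixed_comparable (x, y) (F (x, y), F (y, x)) ->
  (1 - alpha) * mdist (F (x, y)) (F (F (x, y), F (y, x))) <=
  beta / 2 * (mdist x (F (x, y)) + mdist y (F (y, x))).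
Proof.
move=> /ctrF; have := ler_wpM2l alpha0 (M_term_orbit_le F x y); lra.
Qed.

(** The distance from [x] to [F (x, y)] is at most the distance from [x] to
    [x_ n.+1 = F (x_ n, y_ n)] plus the contraction bound between
    [(x_ n, y_ n)] and [(x, y)], and both tend to 0. *)
Lemma contractive_limit_fixed (x_ y_ : nat -> X) (x y : X) :
  (forall n, x_ n.+1 = F (x_ n, y_ n)) ->
  (forall n, mixed_comparable (x_ n, y_ n) (x, y)) ->
  x_ n @[n --> \oo] --> x -> y_ n @[n --> \oo] --> y -> F (x, y) = x.
Proof.
move=> xS xy_cmp xx yy; apply/esym/mdist_positivity/eqP.
rewrite eq_le mdist_ge0 andbT.
have dx := cvg_mdist0 xx; have dy := cvg_mdist0 yy.
have dxS : mdist x (x_ n.+1) @[n --> \oo] --> (0 : R).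
  by move: dx; rewrite -cvg_shiftS.
set C := 2 + mdist x (F (x, y)) + mdist y (F (y, x)).
pose bound n := mdist x (x_ n.+1) +
  (alpha * ((mdist x (x_ n) + mdist x (x_ n.+1)) * C) +
   beta / 2 * (mdist x (x_ n) + mdist y (y_ n))).
have C0 : 0 <= C by rewrite /C !addr_ge0 ?mdist_ge0.
have le_bound n : mdist x (F (x, y)) <= bound n.
  apply: le_trans (metric_triangle _ (x_ n.+1) _) _.
  rewrite lerD2l {1}xS (le_trans (ctrF (xy_cmp n)))// (metric_sym (x_ n)).
  rewrite (metric_sym (y_ n)) lerD2r ler_wpM2l//.
  apply: le_trans (M_term_le F _ _ _ _) _; rewrite ler_wpM2r// -xS.
  by rewrite (le_trans (metric_triangle _ x _))// metric_sym.
have bound0 : bound n @[n --> \oo] --> (0 : R).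
  have -> : 0 = 0 + (alpha * ((0 + 0) * C) + beta / 2 * (0 + 0)) :> R.
    by rewrite !addr0 mul0r !mulr0 !addr0.
  apply: cvgD => //; apply: cvgD; apply: cvgMr; last exact: cvgD.
  by apply: cvgMl; exact: cvgD.
have := @limr_ge _ _ _ _ (mdist x (F (x, y))) bound (cvgP _ bound0).
rewrite (cvg_lim _ bound0)//; apply; exact: nearW.
Qed.

End contractive_maps.

Definition coupled_map (X : Type) (F : X * X -> X) (p : X * X) : X * X :=
  (F p, F (p.2, p.1)).

Lemma coupled_map_homo (d : Order.disp_t) (X : porderType d) (F : X * X -> X)
    (p q : X * X) : mixed_monotone F ->
  (p.1 <= q.1)%O /\ (q.2 <= p.2)%O ->
  ((coupled_map F p).1 <= (coupled_map F q).1)%O /\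
  ((coupled_map F q).2 <= (coupled_map F p).2)%O.
Proof.
move=> mF; case: p q => x y [u v] /= [xu vy]; split.
  exact: le_trans ((mF x y).1 _ _ xu) ((mF u y).2 _ _ vy).
exact: le_trans ((mF v u).1 _ _ vy) ((mF y u).2 _ _ xu).
Qed.

Theorem theorem2 (R : realType) (disp : Order.disp_t)
  (X : completePOrderMetricType disp R)
  (hnondec : forall (x_ : nat -> X) (x : X),
     nondecreasing_seq x_ -> x_ n @[n --> \oo] --> x ->
     forall n, (x_ n <= x)%O)
  (hnoninc : forall (y_ : nat -> X) (y : X),
     nonincreasing_seq y_ -> y_ n @[n --> \oo] --> y ->
     forall n, (y_ n >= y)%O)
  (F : X * X -> X) (hF : mixed_monotone F)
  (hcontr : exists alpha beta : R,
     [/\ 0 < alpha, 0 < beta, alpha + beta < 1 &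
      forall x y u v : X, (x >= u)%O -> (y <= v)%O ->
        mdist (F (x, y)) (F (u, v)) <=
          alpha * M_term F (x, y) (u, v) +
          beta / 2 * (mdist x u + mdist y v)])
  (hinit : exists x0 y0 : X, (x0 <= F (x0, y0))%O /\ (y0 >= F (y0, x0))%O) :
  exists x y : X, coupled_fixed_point F x y.
Proof.
case: hcontr => a [b [a0 b0 ab /contractive_of_ge ctr]].
case: hinit => x0 [y0 [hx0 hy0]].
pose p n := iter n (coupled_map F) (x0, y0).
pose x_ n := (p n).1; pose y_ n := (p n).2.
have xS n : x_ n.+1 = F (x_ n, y_ n).
  by rewrite /x_ /y_ /p iterS /=; case: (iter _ _ _).
have yS n : y_ n.+1 = F (y_ n, x_ n) by [].
have mono n : (x_ n <= x_ n.+1)%O /\ (y_ n.+1 <= y_ n)%O.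
  elim: n => [//|n IH].
  by rewrite /x_ /y_ /p !(iterS _.+1) (iterS n); exact: coupled_map_homo.
have cmp n : mixed_comparable (x_ n, y_ n) (F (x_ n, y_ n), F (y_ n, x_ n)).
  by left; rewrite -xS -yS; exact: mono.
pose s n := mdist (x_ n) (x_ n.+1) + mdist (y_ n) (y_ n.+1).
pose q := b / (1 - a).
have a1 : 0 < 1 - a by lra.
have q01 : 0 <= q < 1.
  by rewrite /q divr_ge0 ?ltW//= ltr_pdivrMr// mul1r; lra.
have s_ge0 n : 0 <= s n by rewrite addr_ge0 ?mdist_ge0.
have s_step n : s n.+1 <= q * s n.
  have := contractive_step (ltW a0) ctr (cmp n).
  have := contractive_step (ltW a0) ctr (mixed_comparable_swap (cmp n)).
  (* Explicit instances: [x_] and [y_] unfold, so an open pattern would match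
     up to conversion. *)
  rewrite -(xS n) -(yS n) -(xS n.+1) -(yS n.+1) => hy hx.
  by rewrite /q mulrAC ler_pdivlMr// /s; lra.
have s_geo n : s n <= s 0 * q ^+ n.
  elim: n => [|n IH]; first by rewrite expr0 mulr1.
  rewrite exprS mulrCA (le_trans (s_step n))// ler_wpM2l//.
  by case/andP: q01.
have /cauchy_cvg/cvg_ex[x xx] : cauchy (x_ n @[n --> \oo]).
  apply: (cauchy_geometric_steps (s_ge0 0) q01) => n.
  by apply: le_trans (s_geo n); rewrite lerDl mdist_ge0.
have /cauchy_cvg/cvg_ex[y yy] : cauchy (y_ n @[n --> \oo]).
  apply: (cauchy_geometric_steps (s_ge0 0) q01) => n.
  by apply: le_trans (s_geo n); rewrite lerDr mdist_ge0.
have limcmp n : mixed_comparable (x_ n, y_ n) (x, y).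
  left; split.
    by apply: hnondec xx n; apply/nondecreasing_seqP => n; case: (mono n).
  by apply: hnoninc yy n; apply/nonincreasing_seqP => n; case: (mono n).
exists x, y; split.
  exact: (contractive_limit_fixed (ltW a0) ctr xS limcmp xx yy).
apply: (contractive_limit_fixed (ltW a0) ctr yS _ yy xx) => n.
exact/mixed_comparable_swap.
Qed.
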